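(* Let $\mathsf{C}$ be a strict braided monoidal category. Let $(f,g)$ be a morphism between generalized invertible 1-cocycles $(\pi:B\to H,\theta_\pi)$ and $(\pi':B'\to H',\theta_{\pi'})$ in $\mathsf{C}$, with actions $\phi_H$ and $\phi_{H'}$ respectively. Then there exists a functor $$\mathsf{M}_{(f,g)}:{}_{(\pi',\phi_{H'},\theta_{\pi'})}\mathsf{Mod}\to{}_{(\pi,\phi_H,\theta_\pi)}\mathsf{Mod}$$ defined on objects by $$\mathsf{M}_{(f,g)}((P,Q,\phi_P,\varphi_P,\phi_Q,\tau))=(P,Q,\ \phi_P\circ(f\otimes P),\ \varphi_P\circ(g\otimes P),\ \phi_Q\circ(f\otimes Q),\ \tau)$$ and on morphisms by the identity.
   Context: **Conventions.** $(\mathsf{C},\otimes,K,c)$ is a strict braided monoidal category with unit object $K$ and braiding $c$. For an object $P$ and a morphism $f$, $P\otimes f$ and $f\otimes P$ mean $id_P\otimes f$ and $f\otimes id_P$. Monoids $(A,\eta_A,\mu_A)$ (unit, product) and comonoids $(D,\varepsilon_D,\delta_D)$ (counit, coproduct) and their morphisms are the usual (co)associative (co)unital ones. For comonoids $D,E$, $D\otimes E$ is a comonoid with $\varepsilon_{D\otimes E}=\varepsilon_D\otimes\varepsilon_E$, $\delta_{D\otimes E}=(D\otimes c_{D,E}\otimes E)\circ(\delta_D\otimes\delta_E)$. Left modules over a monoid are the usual unital ones. **Bimonoids, Hopf monoids.** A non-unital bimonoid is a comonoid $(B,\varepsilon_B,\delta_B)$ with an associative product $\mu_B:B\otimes B\to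 B$ (no unit required) that is a comonoid morphism; morphisms of non-unital bimonoids are multiplicative comonoid morphisms. A bimonoid is an object that is a monoid and a comonoid such that unit and product are comonoid morphisms; a Hopf monoid is a bimonoid $H$ with an antipode $\lambda_H:H\to H$, i.e. $\mu_H\circ(H\otimes\lambda_H)\circ\delta_H=\eta_H\circ\varepsilon_H=\mu_H\circ(\lambda_H\otimes H)\circ\delta_H$. Morphisms of Hopf monoids are morphisms of monoids and comonoids. **Non-unital module monoids.** For a non-unital bimonoid $B$, a non-unital left $B$-module is a pair $(M,\phi_M)$ with $\phi_M:B\otimes M\to M$ satisfying $\phi_M\circ(B\otimes\phi_M)=\phi_M\circ(\mu_B\otimes M)$. A monoid $A$ with $\phi_A:B\otimes A\to A$ is a non-unital left $B$-module monoid if $(A,\phi_A)$ is a non-unital left $B$-module, $\phi_A\circ(B\otimes\eta_A)=\varepsilon_B\otimes\eta_A$, and $\phi_A\circ(B\otimes\mu_A)=\mu_A\circ(\phi_A\otimes\phi_A)\circ(B\otimes c_{B,A}\otimes A)\circ(\delta_B\otimes A\otimes A)$. **Generalized invertible 1-cocycles.** Let $H$ be a Hopf monoid, $B$ a non-unital bimonoid, and suppose $H$ is a non-unital left $B$-module monoid with action $\phi_H$. A comonoid morphism $\pi:B\to H$ is a generalized invertible 1-cocycle if it is an isomorphism and there is a comonoid endomorphism $\theta_\pi:B\to B$ with $$\pi\circ\mu_B=\mu_H\circ((\pi\circ\theta_\pi)\otimes\phi_H)\circ(\delta_B\otimes\pi).$$ It is denoted $(\pi:B\to H,\theta_\pi)$.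 A morphism from $(\pi:B\to H,\theta_\pi)$ to $(\pi':B'\to H',\theta_{\pi'})$ is a pair $(f,g)$ with $f:B\to B'$ a morphism of non-unital bimonoids and $g:H\to H'$ a morphism of Hopf monoids such that $f\circ\theta_\pi=\theta_{\pi'}\circ f$, $g\circ\pi=\pi'\circ f$ and $g\circ\phi_H=\phi_{H'}\circ(f\otimes g)$. **Modules over a generalized invertible 1-cocycle.** A left module over $(\pi:B\to H,\theta_\pi)$ is a 6-tuple $(M,N,\phi_M,\varphi_M,\phi_N,\gamma)$ where: (i) $\phi_M:B\otimes M\to M$ is a morphism in $\mathsf{C}$; (ii) $(M,\varphi_M)$ is a left $H$-module; (iii) $(N,\phi_N)$ is a non-unital left $B$-module; (iv) $\phi_M\circ(B\otimes\varphi_M)=\varphi_M\circ(\phi_H\otimes\phi_M)\circ(B\otimes c_{B,H}\otimes M)\circ(\delta_B\otimes H\otimes M)$; (v) $\gamma:N\to M$ is an isomorphism in $\mathsf{C}$ with $\gamma\circ\phi_N=\varphi_M\circ((\pi\circ\theta_\pi)\otimes\phi_M)\circ(\delta_B\otimes\gamma)$. A morphism to $(M',N',\phi_{M'},\varphi_{M'},\phi_{N'},\gamma')$ is a pair $(h,l)$ of morphisms $h:M\to M'$, $l:N\to N'$ in $\mathsf{C}$ with $h\circ\phi_M=\phi_{M'}\circ(B\otimes h)$, $h$ left $H$-linear, $l$ left $B$-linear, and $h\circ\gamma=\gamma'\circ l$. The category is ${}_{(\pi,\phi_H,\theta_\pi)}\mathsf{Mod}$. *)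

(* Defs.v *)
From mathcomp Require Import ssreflect ssrfun ssrbool.
From Stdlib Require Import ProofIrrelevance.

Set Implicit Arguments.
Unset Strict Implicit.
Unset Printing Implicit Defensive.

Declare Scope cat_scope.
Delimit Scope cat_scope with cat.
Local Open Scope cat_scope.

Reserved Notation "f ∘ g" (at level 50, left associativity).
Reserved Notation "A ⊗ B" (at level 40, left associativity).
Reserved Notation "f ⊠ g" (at level 40, left associativity).
Reserved Notation "A ◁ f" (at level 40, left associativity).
Reserved Notation "f ▷ A" (at level 40, left associativity).

Record category := Category {
  ob :> Type;
  hom : ob -> ob -> Type;
  idm : forall A, hom A A;
  mcomp : forall A B C, hom B C -> hom A B -> hom A C;
  mcompA : forall A B C D (f : hom C D) (g : hom B C) (h : hom A B),
    mcomp f (mcomp g h) = mcomp (mcomp f g) h;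
  mcomp1m : forall A B (f : hom A B), mcomp (idm B) f = f;
  mcompm1 : forall A B (f : hom A B), mcomp f (idm A) = f
}.
Arguments hom {c} A B.
Arguments idm {c} A.
Arguments mcomp {c A B C} f g.
Notation "f ∘ g" := (mcomp f g) : cat_scope.

Definition is_iso (C : category) (A B : C) (f : hom A B) : Prop :=
  exists g : hom B A, g ∘ f = idm A /\ f ∘ g = idm B.

Record functor (C D : category) := Functor {
  fob :> C -> D;
  fmor : forall X Y : C, hom X Y -> hom (fob X) (fob Y);
  fmor_id : forall X : C, fmor (idm X) = idm (fob X);
  fmor_comp : forall (X Y Z : C) (u : hom Y Z) (v : hom X Y),
    fmor (u ∘ v) = fmor u ∘ fmor v
}.
Arguments fmor {C D} f {X Y} u.

(* The identity of A, seen as a morphism A -> B along an equality of objects. *)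
Definition eq_hom (C : category) (A B : C) (e : A = B) : hom A B :=
  match e in _ = X return hom A X with eq_refl => idm A end.

(* Strictness is equality of objects; the corresponding equalities between
   morphisms, e.g. (f ⊗ g) ⊗ h = f ⊗ (g ⊗ h), relate terms of different types,
   and are therefore stated up to composition with [eq_hom]. The pentagon and
   triangle identities only involve [eq_hom]s, and hold because proofs of
   equality are irrelevant. *)
Record strict_monoidal := StrictMonoidal {
  mcat :> category;
  tens : mcat -> mcat -> mcat;
  unit_ob : mcat;
  tensm : forall A A' B B' : mcat,
    hom A A' -> hom B B' -> hom (tens A B) (tens A' B');
  tensm_id : forall A B : mcat, tensm (idm A) (idm B) = idm (tens A B);
  tensm_comp : forall (A A' A'' B B' B'' : mcat)
      (f' : hom A' A'') (f : hom A A') (g' : hom B' B'') (g : hom B B'),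
    tensm (f' ∘ f) (g' ∘ g) = tensm f' g' ∘ tensm f g;
  tensA : forall A B C : mcat, tens (tens A B) C = tens A (tens B C);
  tens1o : forall A : mcat, tens unit_ob A = A;
  tenso1 : forall A : mcat, tens A unit_ob = A;
  tensmA : forall (A A' B B' C C' : mcat)
      (f : hom A A') (g : hom B B') (h : hom C C'),
    eq_hom (tensA A' B' C') ∘ tensm (tensm f g) h
    = tensm f (tensm g h) ∘ eq_hom (tensA A B C);
  tensm1l : forall (A A' : mcat) (f : hom A A'),
    eq_hom (tens1o A') ∘ tensm (idm unit_ob) f = f ∘ eq_hom (tens1o A);
  tensm1r : forall (A A' : mcat) (f : hom A A'),
    eq_hom (tenso1 A') ∘ tensm f (idm unit_ob) = f ∘ eq_hom (tenso1 A)
}.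
Arguments tens {s} A B.
Arguments unit_ob {s}.
Arguments tensm {s A A' B B'} f g.
Notation "A ⊗ B" := (tens A B) : cat_scope.
Notation "f ⊠ g" := (tensm f g) : cat_scope.
Notation "A ◁ f" := (tensm (idm A) f) : cat_scope.
Notation "f ▷ A" := (tensm f (idm A)) : cat_scope.

Section Strictness.
Variable C : strict_monoidal.
Definition assoc (X Y Z : C) : hom ((X ⊗ Y) ⊗ Z) (X ⊗ (Y ⊗ Z)) :=
  eq_hom (tensA X Y Z).
Definition assocV (X Y Z : C) : hom (X ⊗ (Y ⊗ Z)) ((X ⊗ Y) ⊗ Z) :=
  eq_hom (eq_sym (tensA X Y Z)).
Definition lunit (X : C) : hom (unit_ob ⊗ X) X := eq_hom (tens1o X).
Definition lunitV (X : C) : hom X (unit_ob ⊗ X) := eq_hom (eq_sym (tens1o X)).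
Definition runit (X : C) : hom (X ⊗ unit_ob) X := eq_hom (tenso1 X).
End Strictness.
Arguments assoc {C} X Y Z.
Arguments assocV {C} X Y Z.
Arguments lunit {C} X.
Arguments lunitV {C} X.
Arguments runit {C} X.

Record strict_braided := StrictBraided {
  bcat :> strict_monoidal;
  braid : forall A B : bcat, hom (A ⊗ B) (B ⊗ A);
  braid_iso : forall A B : bcat, is_iso (braid A B);
  braid_nat : forall (A A' B B' : bcat) (f : hom A A') (g : hom B B'),
    braid A' B' ∘ (f ⊠ g) = (g ⊠ f) ∘ braid A B;
  (* c_{A⊗B,C} = (c_{A,C} ⊗ B) ∘ (A ⊗ c_{B,C}) *)
  braid_hexl : forall A B C : bcat,
    braid (A ⊗ B) C
    = assoc C A B ∘ (braid A C ▷ B) ∘ assocV A C B ∘ (A ◁ braid B C)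
      ∘ assoc A B C;
  (* c_{A,B⊗C} = (B ⊗ c_{A,C}) ∘ (c_{A,B} ⊗ C) *)
  braid_hexr : forall A B C : bcat,
    braid A (B ⊗ C)
    = assocV B C A ∘ (B ◁ braid A C) ∘ assoc B A C ∘ (braid A B ▷ C)
      ∘ assocV A B C
}.
Arguments braid {s} A B.

(* X ⊗ c_{Y,Z} ⊗ W *)
Definition midbraid (C : strict_braided) (X Y Z W : C) :
    hom ((X ⊗ Y) ⊗ (Z ⊗ W)) ((X ⊗ Z) ⊗ (Y ⊗ W)) :=
  assoc (X ⊗ Z) Y W ∘ (assocV X Z Y ▷ W) ∘ ((X ◁ braid Y Z) ▷ W)
  ∘ (assoc X Y Z ▷ W) ∘ assocV (X ⊗ Y) Z W.
Arguments midbraid {C} X Y Z W.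

Section Monoids.
Variable C : strict_braided.

Definition is_assoc (A : C) (mu : hom (A ⊗ A) A) : Prop :=
  mu ∘ (A ◁ mu) ∘ assoc A A A = mu ∘ (mu ▷ A).

Record monoid_on (A : C) := MonoidOn {
  munit : hom unit_ob A;
  mprod : hom (A ⊗ A) A;
  mprodA : is_assoc mprod;
  mprod1l : mprod ∘ (munit ▷ A) = lunit A;
  mprod1r : mprod ∘ (A ◁ munit) = runit A
}.

(* Counit and coproduct without the laws: enough to say that a morphism out of
   D ⊗ E or of the unit object is a comonoid morphism. *)
Record comonoid_data (D : C) := ComonoidData {
  counit : hom D unit_ob;
  coprod : hom D (D ⊗ D)
}.

Record comonoid_on (D : C) := ComonoidOn {
  comon_data :> comonoid_data D;
  coprodA : assoc D D D ∘ (coprod comon_data ▷ D) ∘ coprod comon_data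
            = (D ◁ coprod comon_data) ∘ coprod comon_data;
  coprod1l : lunit D ∘ (counit comon_data ▷ D) ∘ coprod comon_data = idm D;
  coprod1r : runit D ∘ (D ◁ counit comon_data) ∘ coprod comon_data = idm D
}.

Definition unit_comonoid : comonoid_data (@unit_ob C) :=
  ComonoidData (idm unit_ob) (lunitV unit_ob).

Definition tens_comonoid (D E : C) (X : comonoid_data D) (Y : comonoid_data E) :
    comonoid_data (D ⊗ E) :=
  ComonoidData (lunit unit_ob ∘ (counit X ⊠ counit Y))
               (midbraid D D E E ∘ (coprod X ⊠ coprod Y)).

Definition is_comonoid_mor (D E : C) (X : comonoid_data D) (Y : comonoid_data E)
    (f : hom D E) : Prop :=
  counit Y ∘ f = counit X /\ coprod Y ∘ f = (f ⊠ f) ∘ coprod X.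

Definition is_mult (A A' : C) (mu : hom (A ⊗ A) A) (mu' : hom (A' ⊗ A') A')
    (f : hom A A') : Prop :=
  f ∘ mu = mu' ∘ (f ⊠ f).

Definition is_monoid_mor (A A' : C) (X : monoid_on A) (X' : monoid_on A')
    (f : hom A A') : Prop :=
  f ∘ munit X = munit X' /\ is_mult (mprod X) (mprod X') f.

Record nubimonoid := NuBimonoid {
  nub_ob :> C;
  nub_comon : comonoid_on nub_ob;
  nub_prod : hom (nub_ob ⊗ nub_ob) nub_ob;
  nub_prodA : is_assoc nub_prod;
  nub_prod_comon :
    is_comonoid_mor (tens_comonoid nub_comon nub_comon) nub_comon nub_prod
}.

Definition is_nubimonoid_mor (B B' : nubimonoid) (f : hom B B') : Prop :=
  is_comonoid_mor (nub_comon B) (nub_comon B') f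
  /\ is_mult (nub_prod B) (nub_prod B') f.

Record bimonoid := Bimonoid {
  bi_ob :> C;
  bi_mon : monoid_on bi_ob;
  bi_comon : comonoid_on bi_ob;
  bi_unit_comon : is_comonoid_mor unit_comonoid bi_comon (munit bi_mon);
  bi_prod_comon :
    is_comonoid_mor (tens_comonoid bi_comon bi_comon) bi_comon (mprod bi_mon)
}.

Record hopf := Hopf {
  hopf_bi :> bimonoid;
  antipode : hom hopf_bi hopf_bi;
  antipode_r :
    mprod (bi_mon hopf_bi) ∘ (hopf_bi ◁ antipode) ∘ coprod (bi_comon hopf_bi)
    = munit (bi_mon hopf_bi) ∘ counit (bi_comon hopf_bi);
  antipode_l :
    mprod (bi_mon hopf_bi) ∘ (antipode ▷ hopf_bi) ∘ coprod (bi_comon hopf_bi)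
    = munit (bi_mon hopf_bi) ∘ counit (bi_comon hopf_bi)
}.

Definition is_hopf_mor (H H' : hopf) (g : hom H H') : Prop :=
  is_monoid_mor (bi_mon H) (bi_mon H') g
  /\ is_comonoid_mor (bi_comon H) (bi_comon H') g.

Definition is_numodule (B M : C) (mu : hom (B ⊗ B) B) (phi : hom (B ⊗ M) M) :
    Prop :=
  phi ∘ (B ◁ phi) ∘ assoc B B M = phi ∘ (mu ▷ M).

Definition is_module (A M : C) (X : monoid_on A) (phi : hom (A ⊗ M) M) : Prop :=
  is_numodule (mprod X) phi /\ phi ∘ (munit X ▷ M) = lunit M.

Definition is_linear (B M N : C) (phi : hom (B ⊗ M) M) (psi : hom (B ⊗ N) N)
    (h : hom M N) : Prop :=
  h ∘ phi = psi ∘ (B ◁ h).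

(* (phi ⊗ psi) ∘ (B ⊗ c_{B,M} ⊗ N) ∘ (δ_B ⊗ M ⊗ N) *)
Definition diag_action (B : nubimonoid) (M N : C)
    (phi : hom (B ⊗ M) M) (psi : hom (B ⊗ N) N) : hom (B ⊗ (M ⊗ N)) (M ⊗ N) :=
  (phi ⊠ psi) ∘ midbraid (B : C) B M N ∘ (coprod (nub_comon B) ▷ (M ⊗ N)).

Definition is_numodule_monoid (B : nubimonoid) (A : C) (X : monoid_on A)
    (phi : hom (B ⊗ A) A) : Prop :=
  [/\ is_numodule (nub_prod B) phi,
      phi ∘ (B ◁ munit X) = lunit A ∘ (counit (nub_comon B) ⊠ munit X)
    & phi ∘ (B ◁ mprod X) = mprod X ∘ diag_action phi phi].

End Monoids.

Arguments nub_comon {C} n.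
Arguments nub_prod {C} n.
Arguments bi_mon {C} b.
Arguments bi_comon {C} b.

Record gi_cocycle (C : strict_braided) := GICocycle {
  gic_B : nubimonoid C;
  gic_H : hopf C;
  gic_act : hom (gic_B ⊗ gic_H) gic_H;
  gic_actP : is_numodule_monoid (bi_mon gic_H) gic_act;
  gic_pi : hom gic_B gic_H;
  gic_pi_comon : is_comonoid_mor (nub_comon gic_B) (bi_comon gic_H) gic_pi;
  gic_pi_iso : is_iso gic_pi;
  gic_theta : hom gic_B gic_B;
  gic_theta_comon :
    is_comonoid_mor (nub_comon gic_B) (nub_comon gic_B) gic_theta;
  gic_cocycle :
    gic_pi ∘ nub_prod gic_B
    = mprod (bi_mon gic_H) ∘ ((gic_pi ∘ gic_theta) ⊠ gic_act)
      ∘ assoc (gic_B : C) gic_B gic_H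
      ∘ (coprod (nub_comon gic_B) ⊠ gic_pi)
}.
Arguments gic_B {C} g.
Arguments gic_H {C} g.
Arguments gic_act {C} g.
Arguments gic_pi {C} g.
Arguments gic_theta {C} g.

Record gi_cocycle_mor (C : strict_braided) (p p' : gi_cocycle C) :=
    GICocycleMor {
  gicm_f : hom (gic_B p) (gic_B p');
  gicm_g : hom (gic_H p) (gic_H p');
  gicm_fP : is_nubimonoid_mor gicm_f;
  gicm_gP : is_hopf_mor gicm_g;
  gicm_theta : gicm_f ∘ gic_theta p = gic_theta p' ∘ gicm_f;
  gicm_pi : gicm_g ∘ gic_pi p = gic_pi p' ∘ gicm_f;
  gicm_act : gicm_g ∘ gic_act p = gic_act p' ∘ (gicm_f ⊠ gicm_g)
}.
Arguments gicm_f {C p p'} g.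
Arguments gicm_g {C p p'} g.

(* The 6-tuples (M, N, ϕ_M, φ_M, ϕ_N, γ), with no axiom imposed. *)
Record mod_data (C : strict_braided) (B H : C) := ModData {
  md_M : C;
  md_N : C;
  md_phiM : hom (B ⊗ md_M) md_M;
  md_actM : hom (H ⊗ md_M) md_M;
  md_phiN : hom (B ⊗ md_N) md_N;
  md_gamma : hom md_N md_M
}.

Definition mod_hom_data (C : strict_braided) (B H : C) (X Y : mod_data B H) :
    Type :=
  (hom (md_M X) (md_M Y) * hom (md_N X) (md_N Y))%type.

Definition mod_hom_cast (C : strict_braided) (B H : C)
    (X X' Y Y' : mod_data B H) (eX : X = X') (eY : Y = Y')
    (u : mod_hom_data X Y) : mod_hom_data X' Y' :=
  match eX in _ = Z, eY in _ = W return mod_hom_data Z W with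
  | eq_refl, eq_refl => u
  end.

Definition restrict (C : strict_braided) (B B' H H' : C)
    (f : hom B B') (g : hom H H') (X : mod_data B' H') : mod_data B H :=
  {| md_M := md_M X;
     md_N := md_N X;
     md_phiM := md_phiM X ∘ (f ▷ md_M X);
     md_actM := md_actM X ∘ (g ▷ md_M X);
     md_phiN := md_phiN X ∘ (f ▷ md_N X);
     md_gamma := md_gamma X |}.

Section CocycleModules.
Variables (C : strict_braided) (p : gi_cocycle C).

Record is_gi_module (X : mod_data (gic_B p : C) (gic_H p)) : Prop :=
    IsGIModule {
  gim_actM : is_module (bi_mon (gic_H p)) (md_actM X);
  gim_phiN : is_numodule (nub_prod (gic_B p)) (md_phiN X);
  gim_compat :
    md_phiM X ∘ (gic_B p ◁ md_actM X)
    = md_actM X ∘ diag_action (gic_act p) (md_phiM X);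
  gim_gamma_iso : is_iso (md_gamma X);
  gim_gamma :
    md_gamma X ∘ md_phiN X
    = md_actM X ∘ ((gic_pi p ∘ gic_theta p) ⊠ md_phiM X)
      ∘ assoc (gic_B p : C) (gic_B p) (md_M X)
      ∘ (coprod (nub_comon (gic_B p)) ⊠ md_gamma X)
}.

Record gi_module := GIModule {
  gim_data :> mod_data (gic_B p : C) (gic_H p);
  gim_P : is_gi_module gim_data
}.

Record is_gi_module_mor (X Y : gi_module) (u : mod_hom_data X Y) : Prop :=
    IsGIModuleMor {
  gimm_phiM : is_linear (md_phiM X) (md_phiM Y) u.1;
  gimm_actM : is_linear (md_actM X) (md_actM Y) u.1;
  gimm_phiN : is_linear (md_phiN X) (md_phiN Y) u.2;
  gimm_gamma : u.1 ∘ md_gamma X = md_gamma Y ∘ u.2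
}.

Record gi_module_mor (X Y : gi_module) := GIModuleMor {
  gimm_data : mod_hom_data X Y;
  gimm_P : is_gi_module_mor gimm_data
}.

Lemma gi_module_mor_inj (X Y : gi_module) (u v : gi_module_mor X Y) :
  gimm_data u = gimm_data v -> u = v.
Proof.
case: u v => [u uP] [v vP] /= e; subst v.
by rewrite (proof_irrelevance _ uP vP).
Qed.

Lemma is_linear_id (B M : C) (phi : hom (B ⊗ M) M) :
  is_linear phi phi (idm M).
Proof. by rewrite /is_linear tensm_id mcomp1m mcompm1. Qed.

Lemma is_linear_comp (B M N P : C) (phi : hom (B ⊗ M) M) (psi : hom (B ⊗ N) N)
    (rho : hom (B ⊗ P) P) (h : hom N P) (k : hom M N) :
  is_linear psi rho h -> is_linear phi psi k -> is_linear phi rho (h ∘ k).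
Proof.
rewrite /is_linear => hP kP.
by rewrite -mcompA kP mcompA hP -mcompA -tensm_comp mcomp1m.
Qed.

Lemma gi_module_id_subproof (X : gi_module) :
  @is_gi_module_mor X X (idm (md_M X), idm (md_N X)).
Proof.
split=> /=; [exact: is_linear_id | exact: is_linear_id | exact: is_linear_id |].
by rewrite mcomp1m mcompm1.
Qed.

Lemma gi_module_comp_subproof (X Y Z : gi_module)
    (u : gi_module_mor Y Z) (v : gi_module_mor X Y) :
  @is_gi_module_mor X Z
    ((gimm_data u).1 ∘ (gimm_data v).1, (gimm_data u).2 ∘ (gimm_data v).2).
Proof.
case: u v => [u [u1 u2 u3 u4]] [v [v1 v2 v3 v4]]; split=> /=.
- exact: is_linear_comp u1 v1.
- exact: is_linear_comp u2 v2.
- exact: is_linear_comp u3 v3.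
- by rewrite -mcompA v4 mcompA u4 mcompA.
Qed.

Definition gi_module_id (X : gi_module) : gi_module_mor X X :=
  GIModuleMor (gi_module_id_subproof X).

Definition gi_module_comp (X Y Z : gi_module)
    (u : gi_module_mor Y Z) (v : gi_module_mor X Y) : gi_module_mor X Z :=
  GIModuleMor (gi_module_comp_subproof u v).

Lemma gi_module_compA (X Y Z T : gi_module) (u : gi_module_mor Z T)
    (v : gi_module_mor Y Z) (w : gi_module_mor X Y) :
  gi_module_comp u (gi_module_comp v w) = gi_module_comp (gi_module_comp u v) w.
Proof. by apply: gi_module_mor_inj => /=; rewrite !mcompA. Qed.

Lemma gi_module_comp1m (X Y : gi_module) (u : gi_module_mor X Y) :
  gi_module_comp (gi_module_id Y) u = u.
Proof.
by apply: gi_module_mor_inj => /=; rewrite !mcomp1m; case: (gimm_data u).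
Qed.

Lemma gi_module_compm1 (X Y : gi_module) (u : gi_module_mor X Y) :
  gi_module_comp u (gi_module_id X) = u.
Proof.
by apply: gi_module_mor_inj => /=; rewrite !mcompm1; case: (gimm_data u).
Qed.

Definition Mod : category :=
  Category gi_module_compA gi_module_comp1m gi_module_compm1.

End CocycleModules.

(* Main.v *)
(** Each module law for the restricted tuple is the corresponding law over the
    target cocycle precomposed with f and g; these are then moved through the
    structure maps, which are natural (associators, braiding) or commute with
    f and g by hypothesis (products, coproducts, actions, π and θ). *)

From mathcomp Require Import ssreflect ssrfun ssrbool.
Require Import Defs.

Set Implicit Arguments.
Unset Strict Implicit.
Unset Printing Implicit Defensive.

Local Open Scope cat_scope.

Section Naturality.
Variable C : strict_braided.

Lemma eq_homK (A B : C) (e : A = B) : eq_hom (eq_sym e) ∘ eq_hom e = idm A.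
Proof. by case: B / e; rewrite mcomp1m. Qed.

Lemma eq_homVK (A B : C) (e : A = B) : eq_hom e ∘ eq_hom (eq_sym e) = idm B.
Proof. by case: B / e; rewrite mcomp1m. Qed.

(** The strictness axioms give naturality of the casts in one direction only. As casts are
    invertible, such a square can be reversed, which is what [assocV] needs. *)
Lemma eq_homV_nat (A A' B B' : C) (e : A = A') (e' : B = B')
    (f : hom A B) (f' : hom A' B') :
  eq_hom e' ∘ f = f' ∘ eq_hom e ->
  eq_hom (eq_sym e') ∘ f' = f ∘ eq_hom (eq_sym e).
Proof.
move=> sq; rewrite -[f in RHS]mcomp1m -(eq_homK e') -(mcompA _ _ f) sq.
by rewrite -!mcompA eq_homVK mcompm1.
Qed.

Lemma assocV_nat (X X' Y Y' Z Z' : C)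
    (a : hom X X') (b : hom Y Y') (c : hom Z Z') :
  assocV X' Y' Z' ∘ (a ⊠ (b ⊠ c)) = ((a ⊠ b) ⊠ c) ∘ assocV X Y Z.
Proof. exact: eq_homV_nat (tensmA _ _ _). Qed.

Lemma tensm_nat (X1 X1' X2 X2' Y1 Y1' Y2 Y2' : C)
    (u : hom X1 Y1) (u' : hom X1' Y1') (a : hom X1 X1') (b : hom Y1 Y1')
    (v : hom X2 Y2) (v' : hom X2' Y2') (c : hom X2 X2') (d : hom Y2 Y2') :
  u' ∘ a = b ∘ u -> v' ∘ c = d ∘ v ->
  (u' ⊠ v') ∘ (a ⊠ c) = (b ⊠ d) ∘ (u ⊠ v).
Proof. by move=> e1 e2; rewrite -!tensm_comp e1 e2. Qed.

(** Pasting of two commuting squares along the edge [b]. Together with [tensm_nat], it lets the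
    naturality of a long composite be assembled factor by factor. *)
Lemma comp_nat (X X' Y Y' Z Z' : C) (u : hom X Y) (u' : hom X' Y')
    (v : hom Y Z) (v' : hom Y' Z') (a : hom X X') (b : hom Y Y')
    (c : hom Z Z') :
  v' ∘ b = c ∘ v -> u' ∘ a = b ∘ u -> (v' ∘ u') ∘ a = c ∘ (v ∘ u).
Proof. by move=> e1 e2; rewrite -mcompA e2 mcompA e1 mcompA. Qed.

Lemma idm_nat (X X' : C) (a : hom X X') : idm X' ∘ a = a ∘ idm X.
Proof. by rewrite mcomp1m mcompm1. Qed.

Lemma midbraid_nat (X X' Y Y' Z Z' W W' : C)
    (a : hom X X') (b : hom Y Y') (c : hom Z Z') (d : hom W W') :
  midbraid X' Y' Z' W' ∘ ((a ⊠ b) ⊠ (c ⊠ d))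
  = ((a ⊠ c) ⊠ (b ⊠ d)) ∘ midbraid X Y Z W.
Proof.
(* The five factors of [midbraid] are peeled off from the right, each with its own naturality
   square. *)
apply: comp_nat (assocV_nat _ _ _).
apply: comp_nat (tensm_nat (tensmA _ _ _) (idm_nat _)).
apply: comp_nat (tensm_nat (tensm_nat (idm_nat _) (braid_nat _ _)) (idm_nat _)).
exact: comp_nat (tensmA _ _ _) (tensm_nat (assocV_nat _ _ _) (idm_nat _)).
Qed.

Lemma diag_action_nat (B B' : nubimonoid C) (M M' N N' : C)
    (phi : hom (B ⊗ M) M) (phi' : hom (B' ⊗ M') M')
    (psi : hom (B ⊗ N) N) (psi' : hom (B' ⊗ N') N')
    (f : hom B B') (m : hom M M') (n : hom N N') :
  is_comonoid_mor (nub_comon B) (nub_comon B') f ->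
  phi' ∘ (f ⊠ m) = m ∘ phi -> psi' ∘ (f ⊠ n) = n ∘ psi ->
  diag_action phi' psi' ∘ (f ⊠ (m ⊠ n)) = (m ⊠ n) ∘ diag_action phi psi.
Proof.
move=> [_ f_coprod] phi_nat psi_nat.
apply: comp_nat (tensm_nat f_coprod (idm_nat _)).
exact: comp_nat (tensm_nat phi_nat psi_nat) (midbraid_nat _ _ _ _).
Qed.

End Naturality.

Section Restriction.
Variable C : strict_braided.

Lemma numodule_restrict (B B' M : C) (mu : hom (B ⊗ B) B)
    (mu' : hom (B' ⊗ B') B') (f : hom B B') (phi : hom (B' ⊗ M) M) :
  is_mult mu mu' f -> is_numodule mu' phi -> is_numodule mu (phi ∘ (f ▷ M)).
Proof.
rewrite /is_mult /is_numodule => f_mult phiP.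
have -> : phi ∘ (f ▷ M) ∘ (B ◁ (phi ∘ (f ▷ M)))
          = phi ∘ (B' ◁ phi) ∘ (f ⊠ (f ▷ M)).
  by rewrite -!mcompA -!tensm_comp !mcomp1m mcompm1.
(* Moving the associator to the left of the copies of [f] exposes the action law of [phi] over
   [B']. *)
rewrite -(mcompA _ _ (assoc _ _ _)) -tensmA mcompA phiP.
by rewrite -!mcompA -!tensm_comp f_mult.
Qed.

Lemma module_restrict (A A' M : C) (X : monoid_on A) (X' : monoid_on A')
    (g : hom A A') (phi : hom (A' ⊗ M) M) :
  is_monoid_mor X X' g -> is_module X' phi -> is_module X (phi ∘ (g ▷ M)).
Proof.
move=> [g_unit g_mult] [phi_mult phi_unit]; split.
  exact: numodule_restrict g_mult phi_mult.
by rewrite -mcompA -tensm_comp g_unit mcomp1m.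
Qed.

Lemma linear_restrict (B B' M N : C) (f : hom B B') (phi : hom (B' ⊗ M) M)
    (psi : hom (B' ⊗ N) N) (h : hom M N) :
  is_linear phi psi h -> is_linear (phi ∘ (f ▷ M)) (psi ∘ (f ▷ N)) h.
Proof.
rewrite /is_linear => hP.
by rewrite mcompA hP -!mcompA -!tensm_comp !mcomp1m !mcompm1.
Qed.

Variables (p p' : gi_cocycle C) (fg : gi_cocycle_mor p p').
Let f := gicm_f fg.
Let g := gicm_g fg.

Lemma gi_module_restrict (X : mod_data (gic_B p' : C) (gic_H p')) :
  is_gi_module X -> is_gi_module (restrict f g X).
Proof.
have [f_comon f_mult] := gicm_fP fg; have [g_mon _] := gicm_gP fg.
case=> actP phiNP compat gamma_iso gammaE; split=> //=.
- exact: module_restrict g_mon actP.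
- exact: numodule_restrict f_mult phiNP.
- have -> : md_phiM X ∘ (f ▷ md_M X) ∘ (gic_B p ◁ (md_actM X ∘ (g ▷ md_M X)))
            = md_phiM X ∘ (gic_B p' ◁ md_actM X) ∘ (f ⊠ (g ▷ md_M X)).
    by rewrite -!mcompA -!tensm_comp !mcomp1m mcompm1.
  (* With [md_actM X] cancelled, what remains is naturality of the diagonal action along [f], [g]
     and the identity of [md_M X]. *)
  rewrite compat -(mcompA (md_actM X)) -[RHS]mcompA; congr (_ ∘ _).
  apply: diag_action_nat => //; first by rewrite -(gicm_act fg).
  by rewrite mcomp1m.
(* This turns the first leg of the formula for [md_gamma X] over [p'] into the one over [p],
   followed by [g]. *)
- have pi_theta : gic_pi p' ∘ gic_theta p' ∘ f = g ∘ (gic_pi p ∘ gic_theta p).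
    by rewrite -mcompA -gicm_theta !mcompA -gicm_pi.
  rewrite mcompA gammaE -mcompA -tensm_comp mcompm1 (proj2 f_comon).
  (* Splitting off [f ⊠ f] leaves the rightmost factor common to both sides; once it is cancelled,
     the associator can be moved past [f ⊠ f] and cancelled too. *)
  have -> : ((f ⊠ f) ∘ coprod (nub_comon (gic_B p))) ⊠ md_gamma X
            = ((f ⊠ f) ▷ md_M X)
              ∘ (coprod (nub_comon (gic_B p)) ⊠ md_gamma X).
    by rewrite -tensm_comp mcomp1m.
  rewrite mcompA; congr (_ ∘ _).
  rewrite -(mcompA _ (assoc _ _ _)) tensmA mcompA; congr (_ ∘ _).
  by rewrite -!mcompA -!tensm_comp !mcomp1m pi_theta.
Qed.

Definition restrict_ob (X : Mod p') : Mod p :=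
  GIModule (gi_module_restrict (gim_P X)).

Lemma gi_module_mor_restrict (X Y : Mod p') (u : hom X Y) :
  @is_gi_module_mor C p (restrict_ob X) (restrict_ob Y) (gimm_data u).
Proof. by case: u => u [u1 u2 u3 u4]; split=> //; exact: linear_restrict. Qed.

Definition restrict_mor (X Y : Mod p') (u : hom X Y) :
    hom (restrict_ob X) (restrict_ob Y) :=
  GIModuleMor (gi_module_mor_restrict u).

(** A module morphism is determined by its underlying pair of maps, and restriction leaves that pair
    unchanged. *)
Lemma restrict_mor_id (X : Mod p') :
  restrict_mor (idm X) = idm (restrict_ob X).
Proof. exact: gi_module_mor_inj. Qed.

Lemma restrict_mor_comp (X Y Z : Mod p') (u : hom Y Z) (v : hom X Y) :
  restrict_mor (u ∘ v) = restrict_mor u ∘ restrict_mor v.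
Proof. exact: gi_module_mor_inj. Qed.

Definition restrict_functor : functor (Mod p') (Mod p) :=
  Functor restrict_mor_id restrict_mor_comp.

End Restriction.

Theorem theorem4p10 (C : strict_braided) (p p' : gi_cocycle C)
    (fg : gi_cocycle_mor p p') :
  exists (F : functor (Mod p') (Mod p))
         (F_ob : forall X : Mod p',
            gim_data (F X) = restrict (gicm_f fg) (gicm_g fg) (gim_data X)),
    forall (X Y : Mod p') (u : hom X Y),
      mod_hom_cast (F_ob X) (F_ob Y) (gimm_data (fmor F u)) = gimm_data u.
(* The equality on objects holds by computation, so with [eq_refl] as its proof the cast reduces to
   the identity. *)
Proof. by exists (restrict_functor fg), (fun=> eq_refl). Qed.
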